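(* Let $H$ be a graph on $t$ vertices with $\operatorname{dom}(H) \ge 1$. For every graph $G$ and each $T \in \mathcal{H}(G)$ define \[ \theta_G(T) = \max\{d_G(v) : v \in \operatorname{Dom}(T)\}, \] and for each $1 \le u \le \operatorname{dom}(H)$ define \[ s^u_G(T) = \frac{1}{\binom{\theta_G(T)-u+1}{t-u}}. \] Then for every $1 \le u \le \operatorname{dom}(H)$, $s^u_G(T)$ is well-defined and decreasing in $\theta_G(T)$, and \[ \sum_{T \in \mathcal{H}(G)} s^u_G(T) \le \frac{N(H_{-u}, K_{t-u})}{\binom{\operatorname{dom}(H)}{u}} \cdot N(K_u, G). \] Furthermore, equality holds \begin{itemize} \item if and only if $G$ has minimum degree at least $t-1$, when $H = S_{t-1}$ for some $t \ge 3$; \item if and only if $G$ contains no isolated vertices and every component of $G$ is regular, when $u = 1$ and $H = S_1$; \item if and only if every component of $G$ that contains a $u$-clique is a complete graph on at least $t$ vertices, when $u \ge 2$ or $H$ is not a star. \end{itemize}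
   Context: All graphs are finite and simple. For graphs $F$ and $G$, $N(F,G)$ denotes the number of (not necessarily induced) subgraphs of $G$ isomorphic to $F$, and $\mathcal{H}(G)$ denotes the set of (not necessarily induced) subgraphs of $G$ isomorphic to $H$. A vertex of a graph is dominating if it is adjacent to all other vertices; $\operatorname{Dom}(G)$ is the set of dominating vertices of $G$ and $\operatorname{dom}(G) = |\operatorname{Dom}(G)|$. For $u \le \operatorname{dom}(H)$, $H_{-u}$ denotes the graph obtained from $H$ by removing $u$ dominating vertices (well-defined up to isomorphism). $S_r$ denotes the star with $r$ leaves ($r+1$ vertices). $d_G(v)$ is the degree of $v$ in $G$; a $u$-clique is a complete subgraph on $u$ vertices.
   Formalization: The third equality case is stated only for u < t: when u = t (so H = K_t) both sides equal N(K_t, G) for every G, so the printed ''if and only if'' fails, e.g. H = K_2, u = 2, G a path on 3 vertices; there s is constant, so strict decrease is also stated only for u < t. *)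

(* Defs.v *)
From HB Require Import structures.
From mathcomp Require Import all_boot all_order all_algebra.

Set Implicit Arguments.
Unset Strict Implicit.
Unset Printing Implicit Defensive.

(* The graph without vertices is allowed; it is needed as K_(t - u) when t = u. *)
Record sgraph := SGraph {
  vertex :> finType;
  adj : rel vertex;
  adj_sym : symmetric adj;
  adj_irr : irreflexive adj }.

Notation "x -- y" := (adj x y) (at level 30).

Definition iso (A B : sgraph) : Prop :=
  exists2 f : A -> B, bijective f & forall x y, f x -- f y = x -- y.

Definition isob (A B : sgraph) : bool :=
  (#|A| == #|B|) &&
  [exists f : {ffun A -> B},
     injectiveb f && [forall x, forall y, f x -- f y == x -- y]].

Lemma isoP (A B : sgraph) : reflect (iso A B) (isob A B).
Proof.
apply: (iffP andP) => [[/eqP eqAB /existsP[f /andP[/injectiveP injf /forallP Hf]]]|].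
  exists f; first by apply: inj_card_bij => //; rewrite eqAB.
  by move=> x y; apply/eqP; have /forallP := Hf x; apply.
case=> f bijf Hf; split; first by apply/eqP; apply: bij_eq_card bijf.
apply/existsP; exists [ffun x => f x]; apply/andP; split.
  by apply/injectiveP => x y; rewrite !ffunE; apply: bij_inj bijf _ _.
by apply/forallP=> x; apply/forallP=> y; rewrite !ffunE Hf.
Qed.

Definition complete (A : sgraph) : Prop := forall x y : A, x != y -> x -- y.

Definition deg (G : sgraph) (v : G) : nat := #|[set w | v -- w]|.

Definition regular (G : sgraph) : Prop := exists d, forall v : G, deg v = d.

Definition Dom (G : sgraph) : {set G} :=
  [set v | [forall w, (w != v) ==> v -- w]].

Definition dom (G : sgraph) : nat := #|Dom G|.

Section CompleteGraph.
Variable n : nat.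
Definition complete_rel : rel 'I_n := fun x y => x != y.
Lemma complete_rel_sym : symmetric complete_rel.
Proof. by move=> x y; rewrite /complete_rel eq_sym. Qed.
Lemma complete_rel_irr : irreflexive complete_rel.
Proof. by move=> x; rewrite /complete_rel eqxx. Qed.
Definition complete_graph := SGraph complete_rel_sym complete_rel_irr.
End CompleteGraph.

Section Star.
Variable r : nat.
(* The centre is [ord0]: adjacent means that exactly one endpoint is the centre. *)
Definition star_rel : rel 'I_r.+1 := fun x y => (x == ord0) (+) (y == ord0).
Lemma star_rel_sym : symmetric star_rel.
Proof. by move=> x y; rewrite /star_rel addbC. Qed.
Lemma star_rel_irr : irreflexive star_rel.
Proof. by move=> x; rewrite /star_rel addbb. Qed.
Definition star := SGraph star_rel_sym star_rel_irr.
End Star.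

Definition is_star (H : sgraph) : Prop := exists r, iso H (star r).

Section Induced.
Variables (G : sgraph) (A : {set G}).
Definition induced_rel : rel {x : G | x \in A} := fun x y => val x -- val y.
Lemma induced_rel_sym : symmetric induced_rel.
Proof. by move=> x y; apply: adj_sym. Qed.
Lemma induced_rel_irr : irreflexive induced_rel.
Proof. by move=> x; apply: adj_irr. Qed.
Definition induced := SGraph induced_rel_sym induced_rel_irr.
End Induced.

(* All choices of u dominating vertices give isomorphic graphs; this one removes
   the first u in the enumeration of [Dom H] (meaningful for u <= dom H). *)
Definition del_dom (H : sgraph) (u : nat) : sgraph :=
  induced [set x : H | x \notin take u (enum (Dom H))].

Definition edges (G : sgraph) : {set {set G}} :=
  [set [set p.1; p.2] | p : G * G & p.1 -- p.2].

Lemma edgesP (G : sgraph) (x y : G) : ([set x; y] \in edges G) = x -- y.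
Proof.
apply/imsetP/idP => [[[a b]]|xy]; last by exists (x, y); rewrite ?inE.
rewrite inE /= => ab exy.
have ax : a \in [set x; y] by rewrite exy set21.
have bx : b \in [set x; y] by rewrite exy set22.
move: ax bx; rewrite !inE => /orP[]/eqP ea /orP[]/eqP eb; subst => //.
- by rewrite adj_irr in ab.
- by rewrite adj_sym.
- by rewrite adj_irr in ab.
Qed.

(* A not necessarily induced subgraph is a pair (vertex set, edge set), so that
   subgraphs, and not embeddings, are counted. *)
Record subgraph (G : sgraph) := Subgraph {
  sub_pair : {set G} * {set {set G}};
  _ : (sub_pair.2 \subset edges G)
      && [forall e in sub_pair.2, e \subset sub_pair.1] }.

HB.instance Definition _ (G : sgraph) := [isSub for @sub_pair G].
HB.instance Definition _ (G : sgraph) := [Countable of subgraph G by <:].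
HB.instance Definition _ (G : sgraph) := [Finite of subgraph G by <:].

Section SubgraphGraph.
Variables (G : sgraph) (T : subgraph G).
Definition sub_rel : rel {x : G | x \in (sub_pair T).1} :=
  fun x y => [set val x; val y] \in (sub_pair T).2.
Lemma sub_rel_sym : symmetric sub_rel.
Proof. by move=> x y; rewrite /sub_rel setUC. Qed.
Lemma sub_rel_irr : irreflexive sub_rel.
Proof.
move=> x; apply/negP => xx; case/andP: (valP T) => /subsetP/(_ _ xx).
by rewrite edgesP adj_irr.
Qed.
Definition sub_sgraph := SGraph sub_rel_sym sub_rel_irr.
End SubgraphGraph.

Coercion sub_sgraph : subgraph >-> sgraph.

Definition copies (H G : sgraph) : {set subgraph G} :=
  [set T : subgraph G | isob H T].

Definition N (F G : sgraph) : nat := #|copies F G|.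

(* The maximum over an empty set is 0; this does not occur for copies of a graph
   that has a dominating vertex. *)
Definition theta (G : sgraph) (T : subgraph G) : nat :=
  \max_(v in Dom T) deg (val v : G).

(* [theta - u + 1] is written [theta.+1 - u] because truncated subtraction would
   give the wrong value when u = theta + 1.
   When u = t (which forces H to be complete) the weight is identically 1. *)
Definition weight (t u th : nat) : rat := ('C(th.+1 - u, t - u)%:R^-1)%R.

Definition s (t u : nat) (G : sgraph) (T : subgraph G) : rat :=
  weight t u (theta T).

Definition components (G : sgraph) : {set {set G}} :=
  [set [set w | connect (@adj G) v w] | v : G].

Definition has_clique (u : nat) (G : sgraph) : Prop :=
  exists2 T : subgraph G, complete T & #|T| = u.

(* Main.v *)
Require Import Defs.
From mathcomp Require Import all_boot all_order all_algebra.
From mathcomp Require Import fingroup perm zify.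

(* Weigh each copy T by the number of u-sets U of dominating vertices of T and
   sum over the u-cliques U of G instead.  A copy T with U inside Dom T is
   recovered from T - U, which is a copy of H_(-u) placed on t - u of the w
   common neighbours of U; there are at most C(w, t - u) N(H_(-u), K_(t-u)) of
   these.  Every vertex of U has degree at least w + u - 1, so each of them has
   weight at most 1 / C(w, t - u), and U contributes at most
   N(H_(-u), K_(t-u)).  Equality forces w >= t - u, all placements to lie in G
   and theta T = w + u - 1 throughout; so, when u < t, every vertex of U has
   closed neighbourhood U together with its common neighbours W.  If u >= 2 one
   exchanges vertices between U and W, and if H is not a star an edge of H_(-1)
   can be placed on any pair in W; either way the component of U is complete. *)

Set Implicit Arguments.
Unset Strict Implicit.
Unset Printing Implicit Defensive.

Import Order.TTheory GRing.Theory Num.Theory.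

(** * Moving one finite set onto another by a permutation *)

(** Induction on the size of [A :\: B]: the transposition of some [a] in [A :\: B] with some [b] in
    [B :\: A] stays inside [S] and shrinks that difference by one. *)
Lemma perm_on_imset (V : finType) (S A B : {set V}) :
  A \subset S -> B \subset S -> #|A| = #|B| ->
  exists2 s : {perm V}, perm_on S s & s @: A = B.
Proof.
move: {2}#|A :\: B| (erefl #|A :\: B|) => k.
elim: k A => [|k IH] A cardAB sAS sBS eqAB.
  exists 1%g; first exact: perm_on1.
  have AB : A \subset B by rewrite -setD_eq0 -cards_eq0 cardAB.
  have -> : A = B by apply/eqP; rewrite eqEcard AB eqAB /=.
  by rewrite (eq_imset _ (@perm1 V)) imset_id.
have [a aAB] : exists a, a \in A :\: B by apply/card_gt0P; rewrite cardAB.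
have [b bBA] : exists b, b \in B :\: A.
  apply/card_gt0P; have := cardsID A B; have := cardsID B A.
  rewrite setIC; lia.
move: (aAB) (bBA); rewrite !inE => /andP[aB aA] /andP[bA bB].
have aS := subsetP sAS _ aA; have bS := subsetP sBS _ bB.
have eqA' : tperm a b @: A = b |: (A :\ a).
  apply/setP=> x; rewrite -{1}(tpermK a b x) (mem_imset _ _ perm_inj) !inE.
  case: tpermP => [->|->|]; rewrite ?aA ?eqxx ?(negPf bA) ?andbF ?orbF ?orTb //.
  - by apply/esym/eqP => eab; rewrite -eab aA in bA.
  - by move=> /eqP/negPf -> /eqP/negPf ->.
have cA' : #|tperm a b @: A| = #|A| by rewrite card_imset //; apply: perm_inj.
have sA' : tperm a b @: A \subset S.
  by rewrite eqA' subUset sub1set bS (subset_trans (subsetDl _ _)).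
have dA' : #|tperm a b @: A :\: B| = k.
  have -> : tperm a b @: A :\: B = (A :\: B) :\ a.
    rewrite eqA'; apply/setP => x; rewrite !inE.
    by case: (eqVneq x b) => [->|]; rewrite ?bB ?andbF //= andbCA.
  by have := cardsD1 a (A :\: B); rewrite aAB cardAB add1n => -[].
have [s sS sAB] := IH _ dA' sA' sBS (etrans cA' eqAB).
exists (tperm a b * s)%g.
  apply: perm_onM => //; apply/subsetP => x; rewrite inE.
  by case: tpermP => [->|->|]; rewrite ?eqxx.
rewrite -sAB -imset_comp; apply: eq_imset => x; exact: permM.
Qed.

(** * Copies of a graph as images of injections *)

Definition vset (G : sgraph) (T : subgraph G) : {set G} := (sub_pair T).1.
Definition eset (G : sgraph) (T : subgraph G) : {set {set G}} := (sub_pair T).2.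
Definition domset (G : sgraph) (T : subgraph G) : {set G} :=
  [set val x | x in Dom T].

(** The target [V] carries no adjacency, so these edge sets make sense in [G], in a complete graph,
    and on vertices of [G] where the edges may be missing. *)
Definition img_edges (F : sgraph) (V : finType) (f : F -> V) : {set {set V}} :=
  [set [set f p.1; f p.2] | p : F * F & p.1 -- p.2].

Lemma subgraph_eq (G : sgraph) (S T : subgraph G) :
  vset S = vset T -> eset S = eset T -> S = T.
Proof.
rewrite /vset /eset => eqv eqe; apply: val_inj.
by move: eqv eqe => /=; case: (sub_pair S) (sub_pair T) => [? ?] [? ?] /= -> ->.
Qed.

Lemma img_edgesP (F : sgraph) (V : finType) (f : F -> V) (e : {set V}) :
  reflect (exists x y, x -- y /\ e = [set f x; f y]) (e \in img_edges f).
Proof.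
apply: (iffP imsetP) => [[[x y]]|[x [y [xy ->]]]].
  by rewrite inE /= => xy ->; exists x, y.
by exists (x, y); rewrite ?inE.
Qed.

Lemma img_edges_sub (F : sgraph) (V : finType) (f : F -> V) (e : {set V}) :
  e \in img_edges f -> e \subset f @: [set: F].
Proof.
by case/img_edgesP=> x [y [_ ->]]; rewrite subUset !sub1set !imset_f ?inE.
Qed.

Lemma mem_img_edges (F : sgraph) (V : finType) (f : F -> V) x y :
  injective f -> ([set f x; f y] \in img_edges f) = x -- y.
Proof.
move=> injf; apply/img_edgesP/idP => [[a [b [ab exy]]]|xy]; last by exists x, y.
have := set21 (f a) (f b); have := set22 (f a) (f b); rewrite -exy !inE.
case/orP=> /eqP/injf eb /orP[]/eqP/injf ea; subst => //.
- by rewrite adj_irr in ab.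
- by rewrite adj_sym.
- by rewrite adj_irr in ab.
Qed.

Lemma eq_img_edges (F : sgraph) (V : finType) (f g : F -> V) :
  f =1 g -> img_edges f = img_edges g.
Proof. by move=> fg; apply: eq_imset => p; rewrite !fg. Qed.

Lemma img_edges_comp (F : sgraph) (V V' : finType) (f : F -> V) (g : V -> V') :
  img_edges (g \o f) = [set g @: e | e : {set V} in img_edges f].
Proof.
apply/setP=> e; apply/img_edgesP/imsetP.
  move=> [x [y [xy ->]]]; exists [set f x; f y]; last by rewrite imsetU1 imset_set1.
  by apply/img_edgesP; exists x, y.
move=> [_ /img_edgesP[x [y [xy ->]]] ->].
by exists x, y; rewrite imsetU1 imset_set1.
Qed.

Lemma edgesE (G : sgraph) (e : {set G}) :
  e \in edges G -> exists x y, x -- y /\ e = [set x; y].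
Proof. by case/imsetP => -[x y]; rewrite inE /= => xy ->; exists x, y. Qed.

Lemma eset_edges (G : sgraph) (T : subgraph G) : eset T \subset edges G.
Proof. by case/andP: (valP T). Qed.

Lemma subgraph_of (G : sgraph) (X : {set G}) (E : {set {set G}}) :
  E \subset edges G -> (forall e, e \in E -> e \subset X) ->
  exists T : subgraph G, vset T = X /\ eset T = E.
Proof.
move=> EG EX.
have ok : ((X, E).2 \subset edges G)
      && [forall e in (X, E).2, e \subset (X, E).1].
  by rewrite EG; apply/forall_inP.
by exists (Subgraph ok).
Qed.

Definition is_copy (F G : sgraph) (f : F -> G) (T : subgraph G) : Prop :=
  [/\ injective f, vset T = f @: [set: F] & eset T = img_edges f].

(** Trades an isomorphism onto the graph on a subtype for an injection into [G], so that copies can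
    be handled through [vset] and [eset] alone. *)
Lemma copiesP (H G : sgraph) (T : subgraph G) :
  reflect (exists f : H -> G, is_copy f T) (T \in copies H G).
Proof.
rewrite inE; apply: (iffP (isoP _ _)) => [[g bijg Hg]|[f [injf vT eT]]].
  have injg := bij_inj bijg; exists (fun x => val (g x)); split.
  - by move=> x y /val_inj/injg.
  - apply/setP=> x; apply/idP/imsetP => [xT|[y _ ->]]; last exact: valP.
    case: bijg => h _ gh; exists (h (exist _ x xT)) => //=.
    by rewrite gh.
  - apply/setP=> e; apply/idP/img_edgesP => [eT|[x [y [xy ->]]]].
      have /edgesE[x [y [xy ee]]] := subsetP (eset_edges T) _ eT.
      have : e \subset vset T by case/andP: (valP T) => _ /forall_inP; apply.
      rewrite ee subUset !sub1set => /andP[xT yT].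
      case: bijg => h _ gh; exists (h (exist _ x xT)), (h (exist _ y yT)).
      by rewrite -Hg !gh; split=> //; rewrite /= /sub_rel /= -ee.
    by rewrite -Hg in xy.
have fT x : f x \in (sub_pair T).1 by rewrite -/(vset T) vT imset_f.
exists (fun x => exist _ (f x) (fT x) : T); last first.
  by move=> x y; rewrite /= /sub_rel /= -/(eset T) eT mem_img_edges.
apply: inj_card_bij => [x y [/injf]//|].
rewrite card_sig -cardsT -(card_imset _ injf) -vT.
by rewrite subset_leq_card //; apply/subsetP => x; rewrite inE.
Qed.

Lemma domset_copy (H G : sgraph) (f : H -> G) (T : subgraph G) :
  is_copy f T -> domset T = f @: Dom H.
Proof.
move=> [injf vT eT].
have fT x : f x \in (sub_pair T).1 by rewrite -/(vset T) vT imset_f.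
have fE x : x \in (sub_pair T).1 -> exists y, x = f y.
  by rewrite -/(vset T) vT => /imsetP[y]; exists y.
apply/setP=> v; apply/imsetP/imsetP => [[[x xT] xD ->]|[x xD ->]] /=.
  have [y xy] := fE _ xT; exists y => //; subst.
  rewrite inE; apply/forallP=> z; apply/implyP => zy.
  move: xD; rewrite inE => /forallP/(_ (exist _ (f z) (fT z)))/implyP.
  rewrite /= /sub_rel /= -/(eset T) eT mem_img_edges //; apply.
  by apply: contra zy => /eqP[] /injf ->.
exists (exist _ (f x) (fT x)) => //; rewrite inE.
apply/forallP => -[w wT]; apply/implyP => /= wx.
have [y ey] := fE _ wT; subst.
rewrite /sub_rel /= -/(eset T) eT mem_img_edges //.
move: xD; rewrite inE => /forallP/(_ y)/implyP; apply.
apply: contra wx => /eqP e; apply/eqP/val_inj; by rewrite /= e.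
Qed.

Lemma theta_domset (G : sgraph) (T : subgraph G) :
  theta T = \max_(v in domset T) deg v.
Proof. by rewrite big_imset //= => x y _ _; apply: val_inj. Qed.

Lemma Dom_adj (H : sgraph) (x y : H) : x \in Dom H -> x != y -> x -- y.
Proof. by rewrite inE => /forallP/(_ y)/implyP xD xy; apply: xD; rewrite eq_sym. Qed.

Lemma perm_Dom_adj (H : sgraph) (p : {perm H}) (x y : H) :
  perm_on (Dom H) p -> p x -- p y = x -- y.
Proof.
move=> pD; case: (eqVneq x y) => [->|xy]; first by rewrite !adj_irr.
have pxy : p x != p y by rewrite (inj_eq perm_inj).
case: (boolP (x \in Dom H)) => [xD|xD].
  by rewrite !Dom_adj // (perm_closed _ pD).
case: (boolP (y \in Dom H)) => [yD|yD]; last by rewrite !(out_perm pD).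
by rewrite adj_sym [RHS]adj_sym !Dom_adj ?(perm_closed _ pD) // eq_sym.
Qed.

(* Permuting dominating vertices is an automorphism of [H], so the deleted
   vertices can be moved onto [U]. *)
Lemma copy_onto (H G : sgraph) (T : subgraph G) (D : {set H}) (U : {set G}) :
  T \in copies H G -> D \subset Dom H -> U \subset domset T -> #|U| = #|D| ->
  exists2 f : H -> G, is_copy f T & f @: D = U.
Proof.
move=> /copiesP[f fT] DH; rewrite (domset_copy fT) => UT cUD.
case: (fT) => injf vT eT.
have fAU : f @: (f @^-1: U) = U.
  apply/setP=> z; apply/imsetP/idP => [[x]|zU]; first by rewrite inE => ? ->.
  by have /imsetP[x _ zx] := subsetP UT _ zU; exists x; rewrite // inE -zx.
have AD : f @^-1: U \subset Dom H.
  apply/subsetP=> x; rewrite inE => /(subsetP UT)/imsetP[y yD /injf ->] //.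
have cA : #|D| = #|f @^-1: U| by rewrite -cUD -{1}fAU card_imset.
have [p pD pA] := perm_on_imset DH AD cA.
exists (f \o p); last by rewrite imset_comp pA.
split; first by apply: inj_comp => //; apply: perm_inj.
  have pT : p @: setT = setT.
    apply/eqP; rewrite -subTset.
    by apply/subsetP=> x _; rewrite -(permKV p x) imset_f.
  by rewrite vT imset_comp pT.
rewrite eT; apply/setP=> e; apply/img_edgesP/img_edgesP => -[x [y [xy ->]]].
  exists ((p^-1)%g x), ((p^-1)%g y); rewrite /= !permKV; split => //.
  by rewrite -(perm_Dom_adj _ _ pD) !permKV.
by exists (p x), (p y); rewrite (perm_Dom_adj _ _ pD).
Qed.

(** * Placements of a graph on a given vertex set *)

(** Edge sets rather than maps are collected, so maps that differ by an automorphism of [F] count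
    once, as they do in [N]. *)
Definition placements (F : sgraph) (V : finType) (B : {set V}) :
    {set {set {set V}}} :=
  [set img_edges f | f : {ffun F -> V} & injectiveb f && (f @: [set: F] == B)].

Lemma placementsP (F : sgraph) (V : finType) (B : {set V}) E :
  reflect (exists f : F -> V, [/\ injective f, f @: [set: F] = B & E = img_edges f])
    (E \in placements F B).
Proof.
apply: (iffP imsetP) => [[f]|[f [injf fB ->]]].
  by rewrite inE => /andP[/injectiveP injf /eqP fB] ->; exists f.
exists (finfun f); last by apply: eq_img_edges => x; rewrite ffunE.
rewrite inE; apply/andP; split.
  by apply/injectiveP => x y; rewrite !ffunE => /injf.
by apply/eqP; rewrite -fB; apply: eq_imset => x; rewrite ffunE.
Qed.

Lemma imset_inj (V V' : finType) (g : V -> V') :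
  injective g -> injective (fun A : {set V} => g @: A).
Proof.
move=> injg A B eqAB; apply/setP=> x.
by rewrite -(mem_imset _ _ injg) eqAB (mem_imset _ _ injg).
Qed.

(** A copy of [F] in a complete graph on [#|F|] vertices is spanning, hence given by its edge set
    alone; the enumeration [g] of [B] carries these edge sets bijectively to the placements on
    [B]. *)
Lemma card_placements (F : sgraph) (V : finType) (B : {set V}) n :
  #|B| = n -> #|F| = n -> #|placements F B| = N F (complete_graph n).
Proof.
move=> cB cF; rewrite /N.
pose g (i : complete_graph n) : V := enum_val (cast_ord (esym cB) i).
have injg : injective g by move=> i j /enum_val_inj/cast_ord_inj.
have gB : g @: setT = B.
  apply/eqP; rewrite eqEcard card_imset // cardsT card_ord cB leqnn andbT.
  by apply/subsetP=> _ /imsetP[i _ ->]; apply: enum_valP.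
have full f (T : subgraph (complete_graph n)) : is_copy (f : F -> _) T -> vset T = setT.
  case=> injf -> _; apply/eqP; rewrite eqEcard subsetT card_imset // !cardsT.
  by rewrite /= card_ord cF leqnn.
pose h (T : subgraph (complete_graph n)) := [set g @: e | e : {set _} in eset T].
rewrite -(card_in_imset (f := h)); last first.
  move=> S T /copiesP[f fS] /copiesP[f' fT] /(imset_inj (imset_inj injg)) eST.
  by apply: subgraph_eq => //; rewrite (full _ _ fS) (full _ _ fT).
apply: eq_card => E; apply/placementsP/imsetP.
  move=> [f [injf fB ->]].
  have fg x : exists i, g i == f x.
    have : f x \in g @: setT by rewrite gB -fB imset_f.
    by case/imsetP=> i _ ->; exists i; rewrite eqxx.
  (* [k] is [f] read back through the enumeration [g]. *)
  pose k x := xchoose (fg x).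
  have gk x : g (k x) = f x by apply: (eqP (xchooseP (fg x))).
  have injk : injective k by move=> x y kxy; apply: injf; rewrite -!gk kxy.
  have [|e /img_edges_sub//|T [vT eT]] :=
    @subgraph_of (complete_graph n) (k @: setT) (img_edges k).
    apply/subsetP=> e /img_edgesP[x [y [xy ->]]]; rewrite edgesP /= /complete_rel.
    by rewrite (inj_eq injk); apply: contraTneq xy => ->; rewrite adj_irr.
  exists T; first by apply/copiesP; exists k.
  by rewrite /h eT -img_edges_comp; apply: eq_img_edges => x /=; rewrite gk.
move=> [T /copiesP[f fT] ->]; exists (g \o f).
case: (fT) => injf vT eT; split; first exact: inj_comp.
  by rewrite imset_comp -vT (full _ _ fT).
by rewrite /h eT img_edges_comp.
Qed.

Lemma placements_gt0 (F : sgraph) (V : finType) (B : {set V}) :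
  #|F| = #|B| -> 0 < #|placements F B|.
Proof.
move=> cFB; apply/card_gt0P.
pose f (x : F) : V := enum_val (cast_ord cFB (enum_rank x)).
have injf : injective f by move=> x y /enum_val_inj/cast_ord_inj/enum_rank_inj.
exists (img_edges f); apply/placementsP; exists f; split=> //.
apply/eqP; rewrite eqEcard card_imset // cardsT cFB leqnn andbT.
by apply/subsetP=> _ /imsetP[i _ ->]; apply: enum_valP.
Qed.

(** * Cliques and common neighbours *)

Definition clique (G : sgraph) (U : {set G}) : bool :=
  [forall x in U, forall y in U, (x != y) ==> x -- y].

Lemma cliqueP (G : sgraph) (U : {set G}) :
  reflect {in U &, forall x y, x != y -> x -- y} (clique U).
Proof.
apply: (iffP forall_inP) => [h x y xU yU|h x xU].
  by have /forall_inP/(_ _ yU)/implyP := h _ xU.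
by apply/forall_inP => y yU; apply/implyP; apply: h.
Qed.

Definition common_nbrs (G : sgraph) (U : {set G}) : {set G} :=
  [set w | [forall x in U, x -- w]].

Lemma common_nbrsP (G : sgraph) (U : {set G}) w :
  reflect {in U, forall x, x -- w} (w \in common_nbrs U).
Proof. by rewrite inE; apply: forall_inP. Qed.

Lemma common_nbrs_disj (G : sgraph) (U : {set G}) : [disjoint U & common_nbrs U].
Proof.
rewrite disjoint_subset; apply/subsetP=> x xU; rewrite inE.
by apply/common_nbrsP => /(_ x xU); rewrite adj_irr.
Qed.

(** The edges forced when every vertex of [U] dominates [U :|: B]. *)
Definition join_edges (V : finType) (U B : {set V}) : {set {set V}} :=
  [set [set p.1; p.2] | p in setX U (U :|: B) & p.1 != p.2].

Lemma join_edgesP (V : finType) (U B : {set V}) e :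
  reflect (exists x y, [/\ x \in U, y \in U :|: B, x != y & e = [set x; y]])
    (e \in join_edges U B).
Proof.
apply: (iffP imsetP) => [[[x y]]|[x [y [xU yU xy ->]]]].
  by rewrite inE in_setX /= => /andP[/andP[xU yU] xy] ->; exists x, y.
by exists (x, y); rewrite // inE in_setX /= xU yU.
Qed.

(** * Splitting a copy along dominating vertices *)

Section Split.
Variables (H G : sgraph) (D : {set H}).
Hypothesis D_Dom : D \subset Dom H.
Let F := induced (~: D).

Lemma card_rest : #|F| = #|H| - #|D|.
Proof. by rewrite card_sig -(cardsC D) addKn; apply: eq_card. Qed.

Lemma rest_imset (V : finType) (f : H -> V) :
  (f \o val) @: [set: F] = f @: (~: D).
Proof.
apply/setP=> z; apply/imsetP/imsetP => [[x _ ->]|[x xD ->]].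
  by exists (val x) => //; apply: valP.
by exists (exist _ x xD).
Qed.

(** The vertices of [D] dominate, so the edges meeting [D] are all the possible ones; any other edge
    has both ends outside [D] and belongs to [F]. *)
Lemma img_edges_split (V : finType) (f : H -> V) : injective f ->
  img_edges f = join_edges (f @: D) (f @: (~: D)) :|: img_edges (f \o val : F -> V).
Proof.
move=> injf; apply/setP=> e; rewrite inE; apply/idP/orP.
  have jn x y : x \in D -> x -- y -> [set f x; f y] \in join_edges (f @: D) (f @: (~: D)).
    move=> xD xy; apply/join_edgesP; exists (f x), (f y).
    rewrite -imsetU setUCr !imset_f ?inE // (inj_eq injf); split=> //.
    by apply: contraTneq xy => ->; rewrite adj_irr.
  move=> /img_edgesP[x [y [xy ->]]].
  case: (boolP (x \in D)) => xD; first by left; apply: jn.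
  case: (boolP (y \in D)) => yD; first by left; rewrite setUC jn // adj_sym.
  have xF : x \in ~: D by rewrite inE.
  have yF : y \in ~: D by rewrite inE.
  by right; apply/img_edgesP; exists (exist _ x xF), (exist _ y yF).
case=> [/join_edgesP[_ [y [/imsetP[x xD ->] + + ->]]]|].
  rewrite -imsetU setUCr => /imsetP[z _ ->] xz.
  apply/img_edgesP; exists x, z; split=> //; apply: Dom_adj.
    exact: subsetP D_Dom _ xD.
  by apply: contra xz => /eqP ->.
by case/img_edgesP=> x [y [xy ->]]; apply/img_edgesP; exists (val x), (val y).
Qed.

Definition local_copies (U : {set G}) : {set subgraph G} :=
  [set T in copies H G | U \subset domset T].

(** The edges in [p.2] need not be edges of [G]: the number of candidates thus depends only on the
    number of common neighbours, and those not realised in [G] contribute to the slack of the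
    inequality. *)
Definition candidates (U : {set G}) : {set {set G} * {set {set G}}} :=
  [set p : {set G} * {set {set G}} |
    [&& p.1 \subset common_nbrs U, #|p.1| == #|F| & p.2 \in placements F p.1]].

Definition strip (U : {set G}) (T : subgraph G) : {set G} * {set {set G}} :=
  (vset T :\: U, [set e in eset T | [disjoint e & U]]).

Lemma card_candidates (U : {set G}) :
  #|candidates U| = ('C(#|common_nbrs U|, #|F|) * N F (complete_graph #|F|))%N.
Proof.
rewrite -cards_draws -sum1_card.
transitivity (\sum_(p : {set G} * {set {set G}} | (p.1 \subset common_nbrs U)
    && (#|p.1| == #|F|) && (p.2 \in placements F p.1)) 1).
  by apply: eq_bigl => p; rewrite inE andbA.
rewrite -(pair_big_dep (fun B : {set G} => (B \subset common_nbrs U) && (#|B| == #|F|))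
  (fun B E => E \in placements F B) (fun _ _ => 1)) /=.
rewrite -sum_nat_const; apply: eq_big => [B|B /andP[_ /eqP cB]]; first by rewrite inE.
by rewrite sum1_card (card_placements cB).
Qed.

(** Join edges meet [U], while the edges of the rest lie in [f @: (~: D)], which avoids [U]; the
    disjointness test in [strip] therefore separates the two. *)
Lemma strip_copy (U : {set G}) (f : H -> G) (T : subgraph G) :
  is_copy f T -> f @: D = U ->
  strip U T = (f @: (~: D), img_edges (f \o val : F -> G)).
Proof.
move=> [injf vT eT] fU; rewrite /strip; congr pair.
  apply/setP=> x; rewrite inE -fU vT; apply/andP/imsetP.
    move=> [xD /imsetP[y _ exy]]; exists y => //; subst.
    by rewrite mem_imset // in xD; rewrite inE.
  by move=> [y yD ->]; rewrite mem_imset // imset_f ?inE // -in_setC yD.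
apply/setP=> e; rewrite inE eT (img_edges_split injf) inE; apply/andP/idP.
  case=> [/orP[/join_edgesP[x [y [xD _ _ ->]]]|//]].
  by move=> /disjointFr/(_ (set21 x y)); rewrite -fU xD.
move=> eF; rewrite eF orbT; split=> //.
have := img_edges_sub eF; rewrite rest_imset => eD.
rewrite disjoint_subset (subset_trans eD) //; apply/subsetP => _ /imsetP[y yD ->].
by rewrite inE -fU mem_imset // -in_setC.
Qed.

Lemma clique_of_copy (U : {set G}) T :
  T \in local_copies U -> clique U.
Proof.
rewrite inE => /andP[/copiesP[f fT]]; rewrite (domset_copy fT) => UT.
case: fT => injf vT eT.
apply/cliqueP => x y /(subsetP UT)/imsetP[a aD ->] /(subsetP UT)/imsetP[b bD ->] ab.
have : [set f a; f b] \in edges G.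
  apply: (subsetP (eset_edges T)); rewrite eT mem_img_edges //.
  by apply: Dom_adj => //; apply: contra ab => /eqP ->.
by rewrite edgesP.
Qed.

(** Rebuilds [T] from its remainder: [copy_onto] lets [U] play the role of [D], and the edges at [U]
    are then forced. *)
Lemma join_strip (U : {set G}) T : #|U| = #|D| -> T \in local_copies U ->
  vset T = U :|: (strip U T).1 /\
  eset T = join_edges U (strip U T).1 :|: (strip U T).2.
Proof.
move=> cU; rewrite inE => /andP[TH UT].
have [f fT fU] := copy_onto TH D_Dom UT cU.
rewrite (strip_copy fT fU) /=; case: fT => injf vT eT; split.
  by rewrite vT -fU -imsetU setUCr.
by rewrite eT img_edges_split // fU.
Qed.

Lemma strip_inj (U : {set G}) : #|U| = #|D| ->
  {in local_copies U &, injective (strip U)}.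
Proof.
move=> cU S T SU TU eST.
have [vS eS] := join_strip cU SU; have [vT eT] := join_strip cU TU.
by apply: subgraph_eq; rewrite ?vS ?vT ?eS ?eT eST.
Qed.

(** A candidate realised in [G] comes from a copy: its placement is extended to [H] by sending [D]
    onto [U], and the added edges lie in [G] because [U] is a clique joined to [B]. *)
Lemma strip_img (U : {set G}) : 0 < #|D| -> #|U| = #|D| -> clique U ->
  strip U @: local_copies U = [set p in candidates U | p.2 \subset edges G].
Proof.
move=> D_gt0 cU clU; apply/setP => -[B E]; rewrite !inE /=; apply/imsetP/idP.
  move=> [T TU]; move: (TU); rewrite inE => /andP[TH UT].
  have [f fT fU] := copy_onto TH D_Dom UT cU.
  rewrite (strip_copy fT fU) => -[-> ->]; case: fT => injf vT eT.
  have sE : img_edges (f \o val : F -> G) \subset edges G.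
    by rewrite (subset_trans _ (eset_edges T)) // eT img_edges_split // subsetUr.
  rewrite sE andbT; apply/and3P; split.
  - apply/subsetP => _ /imsetP[y yD ->]; apply/common_nbrsP => x.
    rewrite -fU => /imsetP[z zD ->]; rewrite -edgesP (subsetP (eset_edges T)) //.
    rewrite eT mem_img_edges //; apply: Dom_adj; first exact: subsetP D_Dom _ zD.
    by apply: contraTneq yD => <-; rewrite inE zD.
  - by rewrite card_imset // card_sig.
  - apply/placementsP; exists (f \o val); rewrite rest_imset; split=> //.
    by apply: inj_comp => //; apply: val_inj.
case/andP => /and3P[BW /eqP cB /placementsP[g [injg gB eE]]] EG.
have [u0 u0U] : exists u0, u0 \in U by apply/card_gt0P; rewrite cU.
(* [D] and [U] are matched along their enumerations; [u0] is only the default of [nth], not reached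
   for [x] in [D]. *)
pose d x := nth u0 (enum U) (index x (enum D)).
have dU x : x \in D -> d x \in U.
  by move=> xD; rewrite -mem_enum mem_nth // -cardE cU cardE index_mem mem_enum.
have injd : {in D &, injective d}.
  move=> x y xD yD /eqP; rewrite nth_uniq ?enum_uniq //; last 2 first.
  - by rewrite -cardE cU cardE index_mem mem_enum.
  - by rewrite -cardE cU cardE index_mem mem_enum.
  by move=> /eqP/(index_inj x); apply; rewrite mem_enum.
(* [insub] succeeds exactly outside [D]; there [h] follows [g], whose values are common neighbours
   of [U] and so avoid [U]. *)
pose h (x : H) : G := if insub x is Some y then g (y : F) else d x.
have hF y : h (val y) = g y by rewrite /h valK.
have hD x : x \in D -> h x = d x by move=> xD; rewrite /h insubF // inE xD.
have gW y : g y \in common_nbrs U by rewrite (subsetP BW) // -gB imset_f.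
have gU y : g y \notin U.
  apply/negP => gyU; have := disjointFr (common_nbrs_disj U) gyU.
  by rewrite gW.
have injh : injective h.
  move=> x y; case: (boolP (x \in D)) => xD; case: (boolP (y \in D)) => yD.
  - by rewrite !hD //; apply: injd.
  - rewrite -in_setC in yD; rewrite hD // (hF (exist _ y yD)) => e.
    by have := gU (exist _ y yD); rewrite -e dU.
  - rewrite -in_setC in xD; rewrite (hF (exist _ x xD)) hD // => e.
    by have := gU (exist _ x xD); rewrite e dU.
  - rewrite -in_setC in xD; rewrite -in_setC in yD.
    by rewrite (hF (exist _ x xD)) (hF (exist _ y yD)) => /injg[].
have hDU : h @: D = U.
  apply/eqP; rewrite eqEcard card_imset // cU leqnn andbT.
  by apply/subsetP => _ /imsetP[x xD ->]; rewrite hD // dU.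
have hcomp : h \o val =1 g by [].
have hDB : h @: (~: D) = B by rewrite -rest_imset -gB; apply: eq_imset.
have hE : img_edges (h \o val : F -> G) = E by rewrite eE; apply: eq_img_edges.
have spl := img_edges_split injh.
have sub : img_edges h \subset edges G.
  rewrite spl hE subUset EG andbT hDU hDB; apply/subsetP => e.
  case/join_edgesP=> x [y [xU + xy ->]]; rewrite edgesP inE => /orP[yU|yB].
    exact: (cliqueP _ clU).
  by have /common_nbrsP/(_ _ xU) := subsetP BW _ yB.
have [|T [vT eT]] := subgraph_of sub (X := h @: setT); first by move=> e /img_edges_sub.
have hT : is_copy h T by [].
exists T; last by rewrite (strip_copy hT hDU) hDB hE.
rewrite inE (domset_copy hT) -{1}hDU imsetS // andbT.
by apply/copiesP; exists h.
Qed.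

End Split.

(** * Closed neighbourhoods, degrees and weights *)

Definition cnbhd (G : sgraph) (v : G) : {set G} := v |: [set w | v -- w].

Lemma card_cnbhd (G : sgraph) (v : G) : #|cnbhd v| = (deg v).+1.
Proof. by rewrite cardsU1 inE adj_irr. Qed.

Lemma in_cnbhd (G : sgraph) (v w : G) : (w \in cnbhd v) = (w == v) || v -- w.
Proof. by rewrite !inE. Qed.

Lemma clique_sub_cnbhd (G : sgraph) (U : {set G}) (v : G) :
  clique U -> v \in U -> U :|: common_nbrs U \subset cnbhd v.
Proof.
move=> /cliqueP clU vU; apply/subsetP=> x.
rewrite in_setU in_cnbhd => /orP[xU|/common_nbrsP->//].
  by case: eqVneq => //= xv; apply: clU => //; rewrite eq_sym.
by rewrite orbT.
Qed.

Lemma card_cliqueU (G : sgraph) (U : {set G}) :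
  #|U :|: common_nbrs U| = #|common_nbrs U| + #|U|.
Proof.
by rewrite cardsU disjoint_setI0 ?common_nbrs_disj // cards0 subn0 addnC.
Qed.

Lemma deg_le_theta (G : sgraph) (T : subgraph G) v :
  v \in domset T -> deg v <= theta T.
Proof. by move=> vT; rewrite theta_domset (leq_bigmax_cond (F := @deg G)). Qed.

Lemma theta_eq (G : sgraph) (T : subgraph G) v :
  v \in domset T -> {in domset T, forall x, deg x <= deg v} -> theta T = deg v.
Proof.
move=> vT vmax; apply/eqP; rewrite eqn_leq deg_le_theta // andbT theta_domset.
by apply/bigmax_leqP.
Qed.

Lemma ltn_bin2l m n k : 0 < k <= m -> m < n -> 'C(m, k) < 'C(n, k).
Proof.
case: k => // k /= km mn; apply: leq_trans (leq_bin2l _ mn).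
by rewrite binS -[X in X < _]addn0 ltn_add2l bin_gt0 ltnW.
Qed.

(** For [u < t] the lower index [t - u] is positive and at most [a.+1 - u], so the binomial grows
    strictly when [a < b]; for [u = t] every weight is 1, whence the first disjunct. *)
Lemma weight_leif t u a b : u <= t -> t <= a.+1 -> a <= b ->
  (weight t u b <= weight t u a ?= iff (u == t) || (b == a))%R.
Proof.
move=> ut ta ab; rewrite /weight.
case: (eqVneq u t) => [->|neq_ut] /=; first by rewrite subnn !bin0; split.
have lt_ut : u < t by rewrite ltn_neqAle neq_ut.
case: (eqVneq b a) => [->|neq_ab]; first by split; rewrite ?eqxx.
have lt_ab : a < b by rewrite ltn_neqAle eq_sym neq_ab.
have Ca : 0 < 'C(a.+1 - u, t - u) by rewrite bin_gt0 leq_sub2r.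
have Cab : 'C(a.+1 - u, t - u) < 'C(b.+1 - u, t - u).
  apply: ltn_bin2l; first by rewrite subn_gt0 lt_ut leq_sub2r.
  by clear -lt_ut ta lt_ab; lia.
apply/leifP; rewrite ltf_pV2 ?ltr_nat // posrE ltr0n //.
exact: leq_trans Cab.
Qed.

Lemma edges_of_clique (G : sgraph) (F : sgraph) (f : F -> G) (B : {set G}) :
  injective f -> f @: [set: F] \subset B -> clique B -> img_edges f \subset edges G.
Proof.
move=> injf fB /cliqueP clB; apply/subsetP=> e /img_edgesP[x [y [xy ->]]].
rewrite edgesP clB ?(subsetP fB) ?imset_f //.
by apply: contraTneq xy => /injf ->; rewrite adj_irr.
Qed.

(** * The local bound at a clique, and double counting *)

Section Count.
Variables (H G : sgraph) (D : {set H}).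
Hypotheses (D_Dom : D \subset Dom H) (D_gt0 : 0 < #|D|).
Let F := induced (~: D).
Let t := #|H|.
Let u := #|D|.
Let LC (U : {set G}) := local_copies H U.

Let u_le_t : u <= t. Proof. exact: max_card. Qed.

Let card_F : #|F| = t - u. Proof. exact: card_rest. Qed.

Lemma local_copies_domset U T : T \in LC U -> U \subset domset T.
Proof. by rewrite inE => /andP[]. Qed.

Lemma card_local_copies (U : {set G}) : #|U| = u -> clique U ->
  #|LC U| <= #|candidates D U|
    ?= iff [forall p in candidates D U, p.2 \subset edges G].
Proof.
move=> cU clU; rewrite -(card_in_imset (strip_inj D_Dom cU)) (strip_img D_Dom D_gt0 cU clU).
set S := [set p in candidates D U | _].
have sub : S \subset candidates D U.
  by apply/subsetP=> p; rewrite inE => /andP[].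
split; first exact: subset_leq_card.
apply/eqP/forall_inP => [ce p pC|h].
  have eS : S = candidates D U by apply/eqP; rewrite eqEcard sub ce leqnn.
  by move: pC; rewrite -eS inE => /andP[].
by apply: eq_card => p; rewrite inE; case: (boolP (p \in _)) => // /h.
Qed.

Lemma local_copies_vset (U : {set G}) T : #|U| = u -> T \in LC U ->
  vset T \subset U :|: common_nbrs U.
Proof.
move=> cU TU; have clU := clique_of_copy TU.
have [-> _] := join_strip D_Dom cU TU; rewrite setUS //.
have : strip U T \in strip U @: LC U by rewrite imset_f.
by rewrite (strip_img D_Dom) // !inE => /andP[/and3P[]].
Qed.

Lemma domset_sub_vset (T : subgraph G) : domset T \subset vset T.
Proof. by apply/subsetP => _ /imsetP[x _ ->]; apply: valP. Qed.

Lemma card_domset (T : subgraph G) : T \in copies H G -> #|domset T| = dom H.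
Proof. by case/copiesP=> f fT; rewrite (domset_copy fT) card_imset //; case: fT. Qed.

Lemma card_vset (T : subgraph G) : T \in copies H G -> #|vset T| = t.
Proof. by case/copiesP=> f [injf -> _]; rewrite card_imset // cardsT. Qed.

(** Any vertex of [U] dominates [T], and its closed neighbourhood in [G] already contains [U] and
    all common neighbours of [U]. *)
Lemma local_theta (U : {set G}) T : #|U| = u -> T \in LC U ->
  #|common_nbrs U| + u <= (theta T).+1.
Proof.
move=> cU TU; have clU := clique_of_copy TU.
have [v vU] : exists v, v \in U by apply/card_gt0P; rewrite cU.
have vT := subsetP (local_copies_domset TU) _ vU.
rewrite -cU -card_cliqueU (leq_trans (subset_leq_card (clique_sub_cnbhd clU vU))) //.
by rewrite card_cnbhd ltnS deg_le_theta.
Qed.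

Let P : rat := (N F (complete_graph (t - u)))%:R%R.

(** Used when [U] has too few common neighbours: the local sum is then 0 and has to be strictly
    below [P]. *)
Let P_gt0 : (0 < P)%R.
Proof.
have c : #|[set: F]| = t - u by rewrite cardsT.
by rewrite ltr0n -(card_placements c card_F) placements_gt0 // cardsT.
Qed.

(** The equality condition of the local bound: enough common neighbours, all placements realised in
    [G], and each [theta T] as small as [local_theta] permits. The last demand is waived at [u = t],
    where the weight is constant. *)
Definition saturated (U : {set G}) : bool :=
  [&& t - u <= #|common_nbrs U|,
      [forall p in candidates D U, p.2 \subset edges G]
    & [forall T in LC U, (u == t) || ((theta T).+1 == #|common_nbrs U| + u)]].

(** Two comparisons are chained: each weight is at most its value [c] at the least possible [theta],
    and there are at most as many copies as candidates. The product of [c] with the number of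
    candidates is exactly [P]. *)
Lemma local_sum (U : {set G}) : #|U| = u -> clique U ->
  (\sum_(T in LC U) s t u T <= P ?= iff saturated U)%R.
Proof.
move=> cU clU; rewrite /saturated; case: leqP => [wle|wlt] /=; last first.
  have -> : LC U = set0.
    apply/eqP; rewrite -cards_eq0 -leqn0.
    apply: leq_trans (card_local_copies cU clU) _.
    by rewrite card_candidates card_F bin_small.
  by rewrite big_set0; apply/leifP.
set w := #|common_nbrs U| in wle *.
(* At [theta = w + u - 1] the upper index [theta.+1 - u] is [w], so [c] is the inverse of
   ['C(w, t - u)]; the predecessor is genuine because [u > 0]. *)
pose c : rat := weight t u (w + u).-1.
have wu : (w + u).-1.+1 = w + u by rewrite prednK // addn_gt0 D_gt0 orbT.
have c_gt0 : (0 < c)%R.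
  by rewrite invr_gt0 ltr0n wu addnK bin_gt0.
have cC : P = (c * #|candidates D U|%:R)%R.
  rewrite card_candidates card_F natrM mulrA /c /weight wu addnK mulVf ?mul1r //.
  by rewrite pnatr_eq0 -lt0n bin_gt0.
have sumc : (\sum_(T in LC U) c = c * #|LC U|%:R)%R.
  by rewrite sumr_const mulr_natr.
rewrite andbC; apply: (leif_trans (x2 := (\sum_(T in LC U) c)%R)).
  apply: leif_sum => T TU.
  have := local_theta cU TU; rewrite -/w -wu ltnS => le.
  rewrite -wu eqSS; apply: weight_leif => //.
  by rewrite wu addnC -leq_subLR.
have [le eqi] := card_local_copies cU clU.
rewrite sumc cC; split; first by rewrite ler_pM2l // ler_nat.
by rewrite (inj_eq (mulfI (lt0r_neq0 c_gt0))) eqr_nat eqi.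
Qed.

(** Every pair of vertices of a copy of a complete graph is one of its edges, so the copy is
    determined by its vertex set. *)
Lemma N_complete k :
  N (complete_graph k) G = #|[set U : {set G} | (#|U| == k) && clique U]|.
Proof.
have cl (T : subgraph G) : T \in copies (complete_graph k) G ->
    [/\ #|vset T| = k, clique (vset T) & eset T = join_edges (vset T) set0].
  move=> TK; move: (TK) => /copiesP[f [injf vT eT]].
  have cv : #|vset T| = k by rewrite vT card_imset // cardsT card_ord.
  have cle : clique (vset T).
    apply/cliqueP => x y; rewrite vT => /imsetP[i _ ->] /imsetP[j _ ->] ij.
    rewrite -edgesP (subsetP (eset_edges T)) // eT mem_img_edges //=.
    by apply: contra ij => /eqP ->.
  split=> //; rewrite eT; apply/setP=> e; apply/img_edgesP/join_edgesP.
    move=> [x [y [xy ->]]]; exists (f x), (f y).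
    by rewrite setU0 vT !imset_f // (inj_eq injf).
  move=> [a [b [+ + ab ->]]]; rewrite setU0 vT => /imsetP[i _ ai] /imsetP[j _ bj].
  by exists i, j; rewrite ai bj; split => //; apply: contraNneq ab; rewrite ai bj => ->.
rewrite /N -(card_in_imset (f := @vset G)); last first.
  move=> S T /cl[_ _ eS] /cl[_ _ eT] vST.
  by apply: subgraph_eq; rewrite // eS eT vST.
apply: eq_card => U; rewrite inE; apply/imsetP/andP.
  by move=> [T /cl[cT clT _] ->]; rewrite cT.
move=> [/eqP cU clU].
pose f (i : complete_graph k) : G := enum_val (cast_ord (esym cU) i).
have injf : injective f by move=> i j /enum_val_inj/cast_ord_inj.
have fU : f @: setT = U.
  apply/eqP; rewrite eqEcard card_imset // cardsT card_ord cU leqnn andbT.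
  by apply/subsetP=> _ /imsetP[i _ ->]; apply: enum_valP.
have [||T [vT eT]] := @subgraph_of G (f @: setT) (img_edges f).
- by rewrite (edges_of_clique injf _ clU) // fU.
- by move=> e /img_edges_sub.
exists T; last by rewrite vT.
by apply/copiesP; exists f.
Qed.

(** After exchanging the sums, [T] appears once for each [u]-subset of [domset T]; such a subset is
    a clique by [clique_of_copy]. *)
Lemma double_count (w : subgraph G -> rat) :
  (\sum_(U : {set G} | (#|U| == u) && clique U) \sum_(T in LC U) w T
     = 'C(dom H, u)%:R * \sum_(T in copies H G) w T)%R.
Proof.
rewrite (exchange_big_dep (mem (copies H G))) /=; last first.
  by move=> U T _; rewrite inE => /andP[].
rewrite mulr_sumr; apply: eq_bigr => T TH.
rewrite sumr_const mulr_natl; congr (_ *+ _)%R.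
rewrite -(card_domset TH) -cards_draws; apply: eq_card => U.
rewrite [in RHS]inE unfold_in /=; apply/andP/andP.
  by move=> [/andP[cU _]]; rewrite inE => /andP[_ UT].
move=> [UT cU]; have TU : T \in LC U by rewrite inE TH UT.
by rewrite cU TU (clique_of_copy TU).
Qed.

Lemma global_sum :
  (\sum_(T in copies H G) s t u T
    <= P / 'C(dom H, u)%:R * (N (complete_graph u) G)%:R
    ?= iff [forall U : {set G}, ((#|U| == u) && clique U) ==> saturated U])%R.
Proof.
have C_gt0 : (0 < 'C(dom H, u)%:R :> rat)%R.
  by rewrite ltr0n bin_gt0 subset_leq_card.
rewrite N_complete; set K := [set U : {set G} | _].
have -> : (P / 'C(dom H, u)%:R * #|K|%:R = 'C(dom H, u)%:R^-1 *
    \sum_(U : {set G} | (#|U| == u) && clique U) P)%R.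
  rewrite mulrAC mulrC sumr_const mulr_natr; congr (_ * (_ *+ _))%R.
  by apply: eq_card => U; rewrite inE.
have -> : (\sum_(T in copies H G) s t u T = 'C(dom H, u)%:R^-1 *
  \sum_(U : {set G} | (#|U| == u) && clique U) \sum_(T in LC U) s t u T)%R.
  by rewrite double_count mulKf // gt_eqF.
have Cn : ('C(dom H, u)%:R^-1 != 0 :> rat)%R by rewrite invr_eq0 gt_eqF.
have [le eqi] : (\sum_(U : {set G} | (#|U| == u) && clique U) \sum_(T in LC U) s t u T
  <= \sum_(U : {set G} | (#|U| == u) && clique U) P
  ?= iff [forall U : {set G}, ((#|U| == u) && clique U) ==> saturated U])%R.
  by apply: leif_sum => U /andP[/eqP cU clU]; apply: local_sum.
split; first by rewrite ler_pM2l ?invr_gt0.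
by rewrite (inj_eq (mulfI Cn)) eqi.
Qed.

End Count.

(** * Structure forced by saturation *)

Section Equality.
Variables (H G : sgraph) (D : {set H}).
Hypotheses (D_Dom : D \subset Dom H) (D_gt0 : 0 < #|D|).
Let F := induced (~: D).
Let t := #|H|.
Let u := #|D|.

Definition all_saturated : Prop :=
  forall U : {set G}, #|U| = #|D| -> clique U -> saturated D U.

Lemma clique1 (v : G) : clique [set v].
Proof. by apply/cliqueP => x y; rewrite !inE => /eqP -> /eqP ->; rewrite eqxx. Qed.

Lemma common_nbrs1 (v : G) : common_nbrs [set v] = [set w | v -- w].
Proof.
apply/setP=> w; rewrite [RHS]inE; apply/common_nbrsP/idP => [|vw x].
  by apply; rewrite set11.
by rewrite inE => /eqP ->.
Qed.

Lemma card_common_nbrs1 (v : G) : #|common_nbrs [set v]| = deg v.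
Proof. by rewrite common_nbrs1. Qed.

Lemma candidate_local_copy (U : {set G}) p :
  #|U| = u -> clique U -> saturated D U -> p \in candidates D U ->
  exists2 T, T \in local_copies H U & strip U T = p.
Proof.
move=> cU clU /and3P[_ /forall_inP h _] pC.
have : p \in strip U @: local_copies H U.
  by rewrite (strip_img D_Dom D_gt0 cU clU) inE pC h.
by case/imsetP=> T TU ->; exists T.
Qed.

Lemma candidate_exists (U : {set G}) :
  #|F| <= #|common_nbrs U| -> exists p, p \in candidates D U.
Proof.
move=> le; have : 0 < #|[set B : {set G} | (B \subset common_nbrs U) && (#|B| == #|F|)]|.
  by rewrite cards_draws bin_gt0.
case/card_gt0P=> B; rewrite inE => /andP[BW cB].
have /card_gt0P[E EB] := @placements_gt0 F G B (esym (eqP cB)).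
by exists (B, E); rewrite inE BW cB.
Qed.

Lemma saturated_nbrs (U : {set G}) : saturated D U -> #|F| <= #|common_nbrs U|.
Proof. by case/and3P; rewrite /F card_rest. Qed.

Lemma saturated_theta (U : {set G}) T : u < t ->
  saturated D U -> T \in local_copies H U -> (theta T).+1 = #|common_nbrs U| + u.
Proof.
move=> ut /and3P[_ _ /forall_inP h] /h; rewrite -/u -/t ltn_eqF //=.
by move/eqP.
Qed.

(** Some copy passes through [U], and its [theta.+1] equals the size of [U :|: common_nbrs U]. This
    bounds [#|cnbhd v|], so the inclusion in [clique_sub_cnbhd] becomes an equality. *)
Lemma saturated_cnbhd (U : {set G}) v : u < t ->
  #|U| = u -> clique U -> saturated D U -> v \in U ->
  cnbhd v = U :|: common_nbrs U.
Proof.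
move=> ut cU clU sU vU; apply/esym/eqP.
rewrite eqEcard clique_sub_cnbhd //= card_cnbhd card_cliqueU cU.
have [p pC] := candidate_exists (saturated_nbrs sU).
have [T TU _] := candidate_local_copy cU clU sU pC.
rewrite -(saturated_theta ut sU TU) ltnS deg_le_theta //.
exact: subsetP (local_copies_domset TU) _ vU.
Qed.

(* If [H] minus its deleted vertex has an edge, placing that edge on any pair of
   common neighbours forces the pair to be adjacent. *)
Lemma saturated_common_clique (U : {set G}) (x y : F) :
  x -- y -> saturated D U -> clique (common_nbrs U).
Proof.
move=> xy sU; apply/cliqueP => a b aW bW ab.
have [[B E]] := candidate_exists (saturated_nbrs sU).
rewrite inE /= => /and3P[BW cB /placementsP[f [injf fB _]]].
have xny : x != y by apply: contraTneq xy => ->; rewrite adj_irr.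
have sW : [set f x; f y] \subset common_nbrs U.
  by rewrite (subset_trans _ BW) // -fB subUset !sub1set !imset_f ?inE.
have abW : [set a; b] \subset common_nbrs U by rewrite subUset !sub1set aW.
have [|p pW pab] := perm_on_imset sW abW.
  by rewrite !cards2 ab (inj_eq injf) xny.
have pC : (p @: B, img_edges (p \o f)) \in candidates D U.
  rewrite inE /= card_imset ?cB; last exact: perm_inj.
  apply/and3P; split => //.
    apply/subsetP => _ /imsetP[z zB ->]; rewrite (perm_closed _ pW).
    exact: subsetP BW _ zB.
  apply/placementsP; exists (p \o f); rewrite imset_comp fB; split=> //.
  by apply: inj_comp => //; apply: perm_inj.
case/and3P: sU => _ /forall_inP/(_ _ pC)/subsetP/= h _.
rewrite -edgesP; apply: h; apply/img_edgesP; exists x, y; split=> //.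
by rewrite -pab imsetU1 imset_set1.
Qed.

(** Vertices of [U] are settled by [saturated_cnbhd]; a common neighbour [w] is shown to have the
    same closed neighbourhood as a vertex [v] of [U]. *)
Lemma saturated_closed (U : {set G}) : u < t -> all_saturated ->
  (2 <= u \/ exists x y : F, x -- y) -> #|U| = u -> clique U ->
  {in U :|: common_nbrs U, forall w, cnbhd w = U :|: common_nbrs U}.
Proof.
move=> ut sat huF cU clU w; rewrite in_setU => /orP[wU|wW].
  exact: saturated_cnbhd (sat _ cU clU) wU.
have [v vU] : exists v, v \in U by apply/card_gt0P; rewrite cU.
have wU : w \notin U by apply/negP => /(disjointFr (common_nbrs_disj U)); rewrite wW.
have vw : v -- w by apply: (common_nbrsP _ _ wW).
rewrite -(saturated_cnbhd ut cU clU (sat _ cU clU) vU).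
case: (leqP 2 u) => [u2|u1].
  (* The clique [U'] contains [w] and a vertex [v'] kept from [U]: saturation of [U'] equates the
     closed neighbourhoods of [w] and [v'], and saturation of [U] those of [v'] and [v]. *)
  pose U' := w |: (U :\ v).
  have cU' : #|U'| = u.
    by rewrite cardsU1 !inE (negPf wU) andbF /= -cU (cardsD1 v U) vU.
  have clU' : clique U'.
    apply/cliqueP => a b; rewrite !inE =>
      /orP[/eqP ->|/andP[_ aU]] /orP[/eqP ->|/andP[_ bU]].
    - by rewrite eqxx.
    - by move=> _; rewrite adj_sym; apply: (common_nbrsP _ _ wW).
    - by move=> _; apply: (common_nbrsP _ _ wW).
    - exact: (cliqueP _ clU).
  have [v' v'U] : exists v', v' \in U :\ v.
    by apply/card_gt0P; move: u2; rewrite -cU (cardsD1 v U) vU.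
  have v'U' : v' \in U' by rewrite inE v'U orbT.
  have wU' : w \in U' by rewrite !inE eqxx.
  have sU' := sat _ cU' clU'.
  rewrite (saturated_cnbhd ut cU' clU' sU' wU').
  rewrite -(saturated_cnbhd ut cU' clU' sU' v'U').
  rewrite !(saturated_cnbhd ut cU clU (sat _ cU clU)) //.
  by case/setD1P: v'U.
have u_eq1 : u = 1 by apply/eqP; rewrite eqn_leq -ltnS u1.
case: huF => [|[x [y xy]]]; first by rewrite leqNgt u1.
(* For [u = 1] every single vertex is saturated, so every neighbourhood is a clique; adjacent
   vertices then share their closed neighbourhood. *)
have clN (z : G) : clique [set z' | z -- z'].
  rewrite -common_nbrs1; apply: (saturated_common_clique xy).
  by apply: sat; rewrite ?cards1 ?clique1.
have sub (a b : G) : a -- b -> cnbhd a \subset cnbhd b.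
  move=> ab; apply/subsetP=> z; rewrite !in_cnbhd => /orP[/eqP ->|az].
    by rewrite [b -- a]adj_sym ab orbT.
  by case: eqVneq => //= zb; apply: (cliqueP _ (clN a)); rewrite ?inE // eq_sym.
by apply/eqP; rewrite eqEsubset !sub // adj_sym.
Qed.

(** If [v] has the largest degree among the dominating vertices of each copy, then [theta T] is
    [deg v] throughout, and one degree equation settles the last clause of [saturated]. *)
Lemma saturated_intro (U : {set G}) (v : G) :
  #|U| = u -> clique U -> t - u <= #|common_nbrs U| ->
  (forall B : {set G}, B \subset common_nbrs U -> #|B| = #|F| ->
     forall E, E \in placements F B -> E \subset edges G) ->
  v \in U ->
  (forall T, T \in local_copies H U -> {in domset T, forall x, deg x <= deg v}) ->
  (deg v).+1 = #|common_nbrs U| + u ->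
  saturated D U.
Proof.
move=> cU clU le hE vU hdeg dv; apply/and3P; split=> //.
  by apply/forall_inP => -[B E]; rewrite inE => /and3P[BW /eqP cB EB]; apply: (hE B).
apply/forall_inP => T TU; rewrite (theta_eq _ (hdeg _ TU)) ?dv ?eqxx ?orbT //.
exact: subsetP (local_copies_domset TU) _ vU.
Qed.

End Equality.

(** * Components and induced subgraphs *)

Lemma connect_stable (G : sgraph) (A : {set G}) (v w : G) :
  {in A, forall x, [set y | x -- y] \subset A} -> v \in A ->
  connect (@adj G) v w -> w \in A.
Proof.
move=> cl vA vw; have clA : closed (@adj G) (mem A).
  apply: intro_closed => [|x y xy xA]; first by apply: sym_connect_sym; apply: adj_sym.
  by apply: (subsetP (cl x xA)); rewrite inE.
by have : v \in mem A by []; rewrite (closed_connect clA vw).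
Qed.

Lemma complete_inducedP (G : sgraph) (C : {set G}) :
  complete (induced C) <-> clique C.
Proof.
split=> [h|/cliqueP h [x xC] [y yC] xy].
  apply/cliqueP => x y xC yC xy.
  by have := h (exist _ x xC) (exist _ y yC) xy.
exact: h.
Qed.

(** Moves cliques between the graph type [induced C] and subsets of [G]; from right to left, the
    witness takes all edges inside [U]. *)
Lemma has_clique_inducedP (G : sgraph) (C : {set G}) u :
  has_clique u (induced C) <-> exists U : {set G}, [/\ U \subset C, #|U| = u & clique U].
Proof.
split=> [[T compT cT]|[U [UC cU clU]]].
  exists [set val x | x in vset T]; split.
  - by apply/subsetP => _ /imsetP[x _ ->]; apply: valP.
  - by rewrite card_imset; [rewrite -cT card_sig; apply: eq_card | apply: val_inj].
  - apply/cliqueP => _ _ /imsetP[x xT ->] /imsetP[y yT ->] xy.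
    have := compT (exist _ x xT) (exist _ y yT); rewrite /= /sub_rel /= => h.
    suff : @adj (induced C) x y by [].
    rewrite -edgesP (subsetP (eset_edges T)) //; apply: h.
    by apply: contra xy => /eqP[->].
pose X : {set induced C} := [set x | val x \in U].
have EX e : e \in [set e in edges (induced C) | e \subset X] -> e \subset X.
  by rewrite inE => /andP[].
have EG : [set e in edges (induced C) | e \subset X] \subset edges (induced C).
  by apply/subsetP => e; rewrite inE => /andP[].
have [T [vT eT]] := subgraph_of EG EX.
exists T.
  move=> [x xT] [y yT] xy.
  have xX : x \in X by rewrite -vT.
  have yX : y \in X by rewrite -vT.
  rewrite /= /sub_rel /= -/(eset T) eT inE edgesP subUset !sub1set xX yX andbT.
  rewrite !inE in xX yX; rewrite /= /induced_rel /=.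
  rewrite andbT; apply: (cliqueP _ clU) => //.
rewrite card_sig -cU -/(vset T).
have -> : U = val @: X.
  apply/setP=> z; apply/idP/imsetP => [zU|[x + ->]]; last by rewrite inE.
  have zC := subsetP UC _ zU.
  by exists (exist _ z zC); rewrite // inE.
by rewrite card_imset; [rewrite -vT; apply: eq_card | apply: val_inj].
Qed.

Lemma deg_component (G : sgraph) (C : {set G}) (x : induced C) :
  {in C, forall x, [set y | x -- y] \subset C} -> deg x = deg (val x).
Proof.
move=> cl.
have nE : [set w | val x -- w] = val @: [set w : induced C | x -- w].
  apply/setP=> z; rewrite inE; apply/idP/imsetP => [xz|[y + ->]]; last by rewrite inE.
  have zC : z \in C by apply: (subsetP (cl _ (valP x))); rewrite inE.
  by exists (exist _ z zC); rewrite ?inE.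
by rewrite /deg nE card_imset //; apply: val_inj.
Qed.

Lemma component_closed (G : sgraph) (C : {set G}) :
  C \in components G -> {in C, forall x, [set y | x -- y] \subset C}.
Proof.
case/imsetP=> v _ -> x; rewrite inE => vx; apply/subsetP => y; rewrite !inE => xy.
exact: connect_trans vx (connect1 xy).
Qed.

Lemma component_connect (G : sgraph) (C : {set G}) x y :
  C \in components G -> x \in C -> y \in C -> connect (@adj G) x y.
Proof.
case/imsetP=> v _ ->; rewrite !inE => vx; apply: connect_trans.
by rewrite sym_connect_sym //; apply: adj_sym.
Qed.

Lemma component_of (G : sgraph) (v : G) :
  exists2 C, C \in components G & v \in C.
Proof. by exists [set w | connect (@adj G) v w]; rewrite ?imset_f // inE connect0. Qed.

(** * Recognising stars and their centres *)

Lemma star_iso (H : sgraph) (d : H) :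
  d \in Dom H -> (forall x y : H, x != d -> y != d -> ~~ x -- y) -> is_star H.
Proof.
move=> dD nE; have H_gt0 : 0 < #|H| by apply/card_gt0P; exists d.
exists #|H|.-1.
pose g (x : H) : 'I_#|H|.-1.+1 := cast_ord (esym (prednK H_gt0)) (enum_rank x).
have injg : injective g by move=> x y /cast_ord_inj/enum_rank_inj.
(* The enumeration of [H] is corrected by a transposition so that [d] lands on the centre [ord0]. *)
pose f x := tperm (g d) ord0 (g x).
have injf : injective f by apply: inj_comp => //; apply: perm_inj.
have f0 x : (f x == ord0) = (x == d).
  by rewrite -(inj_eq injf x d) [f d]tpermL.
exists f; first by apply: inj_card_bij => //; rewrite card_ord prednK.
move=> x y; rewrite /= /star_rel !f0.
case: (eqVneq x d) (eqVneq y d) => [->|xd] [->|yd] /=.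
- by rewrite adj_irr.
- by rewrite Dom_adj // eq_sym.
- by rewrite adj_sym Dom_adj // eq_sym.
- by rewrite (negPf (nE x y xd yd)).
Qed.

Lemma nonstar_edge (H : sgraph) (D : {set H}) :
  D \subset Dom H -> #|D| = 1 -> ~ is_star H ->
  exists x y : induced (~: D), x -- y.
Proof.
move=> DH /eqP/cards1P[d eD] nstar; subst.
case: (boolP [exists x : induced (~: [set d]), exists y, x -- y]).
  by case/existsP => x /existsP[y xy]; exists x, y.
move=> h; case: nstar; apply: (@star_iso _ d) => [|x y xd yd].
  by rewrite (subsetP DH) // set11.
have xF : x \in ~: [set d] by rewrite !inE.
have yF : y \in ~: [set d] by rewrite !inE.
move: h; rewrite negb_exists => /forallP/(_ (exist _ x xF)).
by rewrite negb_exists => /forallP/(_ (exist _ y yF)).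
Qed.

(** Since [r >= 2], for a vertex other than the centre there is a third vertex, not adjacent to it;
    so only the centre can dominate. In [star 1] both vertices dominate. *)
Lemma Dom_star (H : sgraph) r : 2 <= r -> iso H (star r) -> 0 < dom H ->
  exists2 c : H, Dom H = [set c] & forall x y : H, x != c -> y != c -> ~~ x -- y.
Proof.
move=> r2 [f bijf adjf] dH; case: (bijf) => h fh hf.
pose c := h ord0; have fc x : (f x == ord0) = (x == c).
  by rewrite -(inj_eq (bij_inj bijf)) hf.
have nE x y : x != c -> y != c -> ~~ x -- y.
  by rewrite -!fc -adjf /= /star_rel => /negPf -> /negPf ->.
exists c => //; have sub : Dom H \subset [set c].
  apply/subsetP=> x xD; rewrite inE; apply/negPn/negP => xc.
  have : 0 < #|~: [set x; c]|.
    have := cardsC [set x; c]; rewrite cards2 xc (bij_eq_card bijf) card_ord; lia.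
  case/card_gt0P=> z; rewrite !inE negb_or => /andP[zx zc].
  by have := nE _ _ xc zc; rewrite Dom_adj // eq_sym.
by apply/eqP; rewrite eqEcard sub cards1.
Qed.

Lemma placement_edgeless (F : sgraph) (V : finType) (B : {set V}) E :
  (forall x y : F, ~~ x -- y) -> E \in placements F B -> E = set0.
Proof.
move=> nE /placementsP[f [_ _ ->]]; apply/setP=> e; rewrite inE.
by apply/img_edgesP => -[x [y [xy _]]]; rewrite (negPf (nE x y)) in xy.
Qed.

(** * The three equality cases *)

Section Cases.
Variables (H G : sgraph) (D : {set H}).
Hypotheses (D_Dom : D \subset Dom H) (D_gt0 : 0 < #|D|).

Lemma all_saturated1 : #|D| = 1 ->
  all_saturated G D <-> forall v : G, saturated D [set v].
Proof.
move=> D1; split=> [h v|h U cU _]; first by apply: h; rewrite ?cards1 ?clique1.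
by have /eqP/cards1P[v ->] : #|U| = 1 by rewrite cU.
Qed.

(** Deleting the centre leaves no edges, so every placement is realised, and [v] is the only
    dominating vertex of a copy through it, so [theta] is [deg v]. What survives is the lower bound
    on the number of neighbours. *)
Lemma all_saturated_star r : 2 <= r -> iso H (star r) ->
  all_saturated G D <-> forall v : G, #|H|.-1 <= deg v.
Proof.
move=> r2 isoH.
have dH : 0 < dom H by apply: leq_trans D_gt0 (subset_leq_card D_Dom).
have [c eDom nE] := Dom_star r2 isoH dH.
have eD : D = [set c] by apply/eqP; rewrite eqEcard -eDom D_Dom eDom cards1.
have D1 : #|D| = 1 by rewrite eD cards1.
rewrite all_saturated1 //; split=> h v.
  by have /and3P[] := h v; rewrite D1 subn1 card_common_nbrs1.
apply: (saturated_intro (v := v));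
  rewrite ?cards1 ?clique1 ?set11 ?card_common_nbrs1 ?D1 ?subn1 ?addn1 //.
  move=> B _ _ E /placement_edgeless -> //; first exact: sub0set.
  have dc z : z \in ~: D -> z != c by rewrite eD in_setC1.
  by move=> x y; apply: nE (dc _ (valP x)) (dc _ (valP y)).
move=> T TU; have TH : T \in copies H G by move: TU; rewrite inE => /andP[].
have := local_copies_domset TU; rewrite sub1set => vT x.
have /eqP/cards1P[z ez] : #|domset T| = 1 by rewrite (card_domset TH) /dom eDom cards1.
by move: vT; rewrite ez !inE => /eqP <- /eqP ->.
Qed.

(** Both ends of a copied edge dominate it, so saturation at [v] says that no neighbour has larger
    degree. Applied at both ends, this makes the degree constant along edges, hence on
    components. *)
Lemma all_saturated_edge : #|D| = 1 -> iso H (star 1) ->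
  all_saturated G D <->
  (forall v : G, deg v != 0) /\
  (forall C, C \in components G -> regular (induced C)).
Proof.
move=> D1 [f bijf adjf].
have cH : #|H| = 2 by rewrite (bij_eq_card bijf) card_ord.
have adjH (x y : H) : x != y -> x -- y.
  rewrite -adjf -(inj_eq (bij_inj bijf)) /= /star_rel.
  by case: (f x) (f y) => [[|[|//]] ?] [[|[|//]] ?].
have domE : dom H = 2.
  rewrite -cH -cardsT; congr #|pred_of_set _|; apply/setP=> x; rewrite !inE.
  by apply/forallP => y; apply/implyP => yx; rewrite adjH // eq_sym.
have cF : #|induced (~: D)| = 1 by rewrite card_rest cH D1.
have nE (x y : induced (~: D)) : ~~ x -- y.
  have /card_le1P/(_ x isT y) : #|induced (~: D)| <= 1 by rewrite cF.
  by rewrite inE => /esym/eqP ->; rewrite adj_irr.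
have vdom T : T \in copies H G -> domset T = vset T.
  move=> TH; apply/eqP; rewrite eqEcard domset_sub_vset (card_domset TH) domE.
  by rewrite (card_vset TH) cH.
rewrite all_saturated1 //; split=> [h|[h0 hreg] v].
  have le (v w : G) : v -- w -> deg w <= deg v.
    (* The remainder [B] yields the copy formed by the edge from [v] to [w], whose [theta] is
       [deg v] by saturation. *)
    move=> vw; pose B : {set G} := [set w].
    have /card_gt0P[E EB] : 0 < #|placements (induced (~: D)) B|.
      by rewrite placements_gt0 // cF cards1.
    have pC : (B, E) \in candidates D [set v].
      by rewrite inE /= common_nbrs1 sub1set inE vw cards1 cF EB.
    have v1 : #|[set v]| = #|D| by rewrite cards1 D1.
    have [T TU eT] := candidate_local_copy D_Dom D_gt0 v1 (clique1 v) (h v) pC.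
    have [vT _] := join_strip D_Dom v1 TU.
    have TH : T \in copies H G by move: TU; rewrite inE => /andP[].
    have u_lt : #|D| < #|H| by rewrite cH D1.
    have := saturated_theta u_lt (h v) TU.
    rewrite card_common_nbrs1 D1 addn1 => -[<-].
    by apply: deg_le_theta; rewrite vdom // vT eT !inE eqxx orbT.
  split=> [v|C CG].
    by have /saturated_nbrs := h v; rewrite cF card_common_nbrs1 lt0n.
  have cl := component_closed CG.
  case: (pickP (mem C)) => [v vC|C0]; last first.
    by exists 0 => -[x xC]; have := C0 x; rewrite /= xC.
  exists (deg v) => x; rewrite deg_component //.
  have := component_connect CG vC (valP x).
  move=> vx; pose A : {set G} := [set y | deg y == deg v].
  have : val x \in A.
    apply: (connect_stable _ _ vx); last by rewrite inE.
    move=> y; rewrite inE => /eqP dy; apply/subsetP => z; rewrite !inE -dy => yz.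
    by rewrite eqn_leq !le // adj_sym.
  by rewrite inE => /eqP.
have dv (w : G) : v -- w -> deg w = deg v.
  move=> vw; have [C CG vC] := component_of v.
  have wC : w \in C by apply: (subsetP (component_closed CG vC)); rewrite inE.
  have cl := component_closed CG; have [d dC] := hreg C CG.
  have := @deg_component _ C (exist _ w wC) cl.
  by have := @deg_component _ C (exist _ v vC) cl; rewrite !dC /= => <- <-.
have v1 : #|[set v]| = #|D| by rewrite cards1 D1.
apply: (saturated_intro (v := v));
  rewrite ?cards1 ?clique1 ?set11 ?card_common_nbrs1 ?cH ?D1 ?subn1 ?addn1 ?lt0n //.
  by move=> B _ _ E /(placement_edgeless nE) ->; apply: sub0set.
move=> T TU x; move/(subsetP (domset_sub_vset T)).
move/(subsetP (local_copies_vset D_Dom D_gt0 v1 TU)).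
by rewrite common_nbrs1 !inE => /orP[/eqP ->|/dv ->].
Qed.

(** Forwards, [saturated_closed] shows that [U] with its common neighbours is the whole component
    and equals each closed neighbourhood in it. Backwards, in a complete component all degrees are
    [#|C|.-1] and every placement is realised. *)
Lemma all_saturated_complete : #|D| < #|H| -> 2 <= #|D| \/ ~ is_star H ->
  all_saturated G D <->
  (forall C, C \in components G -> has_clique #|D| (induced C) ->
     complete (induced C) /\ #|H| <= #|C|).
Proof.
move=> ut hstar; split=> [sat C CG /has_clique_inducedP[U [UC cU clU]]|h U cU clU].
  have hF : 2 <= #|D| \/ exists x y : induced (~: D), x -- y.
    case: (leqP 2 #|D|) => [|u1]; first by left.
    case: hstar => [u2|ns]; first by move: u1; rewrite ltnNge u2.
    by right; apply: nonstar_edge ns => //; apply/eqP; rewrite eqn_leq -ltnS u1.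
  have eqA := saturated_closed D_Dom D_gt0 ut sat hF cU clU.
  set A := U :|: common_nbrs U in eqA.
  have [v vU] : exists v, v \in U by apply/card_gt0P; rewrite cU.
  have vA : v \in A by rewrite inE vU.
  have vC := subsetP UC _ vU.
  have CA : C \subset A.
    apply/subsetP=> x xC; apply: (connect_stable _ _ (component_connect CG vC xC)) => //.
    by move=> y yA; rewrite -(eqA y yA) subsetUr.
  have AC : A \subset C.
    by rewrite -(eqA v vA) subUset sub1set vC (component_closed CG vC).
  split.
    apply/complete_inducedP/cliqueP => x y xC yC xy.
    have : y \in cnbhd x by rewrite (eqA x (subsetP CA _ xC)) (subsetP CA).
    by rewrite in_cnbhd eq_sym (negPf xy).
  apply: leq_trans (subset_leq_card AC); rewrite card_cliqueU cU.
  by have := saturated_nbrs (sat U cU clU); rewrite card_rest leq_subLR addnC.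
have [v vU] : exists v, v \in U by apply/card_gt0P; rewrite cU.
have [C CG vC] := component_of v.
have UC : U \subset C.
  apply/subsetP=> x xU; case: (eqVneq v x) => [<-//|vx].
  by apply: (subsetP (component_closed CG vC)); rewrite inE; apply: (cliqueP _ clU).
have [|/complete_inducedP clC cC] := h C CG.
  by apply/has_clique_inducedP; exists U.
have eN x : x \in C -> cnbhd x = C.
  move=> xC; apply/eqP; rewrite eqEsubset subUset sub1set xC (component_closed CG xC) /=.
  apply/subsetP=> y yC; rewrite in_cnbhd; case: eqVneq => //= yx.
  by apply: (cliqueP _ clC); rewrite // eq_sym.
have WC : U :|: common_nbrs U = C.
  apply/eqP; rewrite eqEsubset -{1}(eN v vC) clique_sub_cnbhd //=.
  apply/subsetP=> x xC; rewrite inE; case: (boolP (x \in U)) => //= xU.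
  apply/common_nbrsP => y yU; apply: (cliqueP _ clC) => //; first exact: subsetP UC _ yU.
  by apply: contraNneq xU => <-.
have cWC : #|common_nbrs U| + #|D| = #|C| by rewrite -cU -card_cliqueU WC.
have degC x : x \in C -> (deg x).+1 = #|C| by move=> xC; rewrite -card_cnbhd eN.
apply: (saturated_intro (v := v)) => //.
- by rewrite leq_subLR addnC cWC.
- move=> B BW _ E /placementsP[f [injf fB ->]].
  apply: edges_of_clique clC => //; rewrite fB (subset_trans BW) //.
  by rewrite -WC subsetUr.
- move=> T TU x xT; have xC : x \in C.
    rewrite -WC; apply: (subsetP (local_copies_vset D_Dom D_gt0 cU TU)).
    exact: subsetP (domset_sub_vset T) _ xT.
  by rewrite -ltnS !degC.
- by rewrite degC // cWC.
Qed.

End Cases.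

(** * Assembling the theorem *)

Lemma del_domE (H : sgraph) u : u <= dom H ->
  exists D : {set H}, [/\ D \subset Dom H, #|D| = u & del_dom H u = induced (~: D)].
Proof.
move=> u_dom; exists [set x in take u (enum (Dom H))]; split.
- by apply/subsetP=> x; rewrite inE => /mem_take; rewrite mem_enum.
- rewrite cardsE; have /card_uniqP -> : uniq (take u (enum (Dom H))).
    by rewrite take_uniq // enum_uniq.
  by rewrite size_takel // -cardE.
- by congr induced; apply/setP=> x; rewrite !inE.
Qed.

(** The closed neighbourhood in [G] of a dominating vertex of [T] contains all [#|H|] vertices of
    [T]. *)
Lemma copy_theta (H G : sgraph) (T : subgraph G) : 0 < dom H ->
  T \in copies H G -> Dom T != set0 /\ #|H| <= (theta T).+1.
Proof.
move=> dH TH; have [v vT] : exists v, v \in domset T.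
  by apply/card_gt0P; rewrite (card_domset TH).
split; first by case/imsetP: vT => x xT _; apply/set0Pn; exists x.
rewrite -(card_vset TH); apply: (@leq_trans (deg v).+1); last by rewrite ltnS deg_le_theta.
rewrite -card_cnbhd subset_leq_card //; apply/subsetP=> w wT.
move: vT wT; case/copiesP: TH => f fT; rewrite (domset_copy fT).
case: fT => injf vT eT; rewrite vT => /imsetP[x xD ->] /imsetP[y _ ->].
rewrite in_cnbhd; case: eqVneq => //= yx; rewrite -edgesP.
apply: (subsetP (eset_edges T)); rewrite eT mem_img_edges //.
by apply: Dom_adj => //; apply: contra yx => /eqP ->.
Qed.

Theorem theorem5p1 (H : sgraph) (t : nat) (card_H : #|H| = t)
    (dom_H : 1 <= dom H) (G : sgraph) (u : nat) (u_dom : 1 <= u <= dom H) :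
  let lhs : rat := (\sum_(T in copies H G) s t u T)%R in
  let rhs : rat :=
    ((N (del_dom H u) (complete_graph (t - u)))%:R / 'C(dom H, u)%:R
       * (N (complete_graph u) G)%:R)%R in
  [/\
    (* s is well-defined on every copy of H *)
    forall T : subgraph G, T \in copies H G ->
      [/\ Dom T != set0, u <= t, t <= (theta T).+1
        & 0 < 'C((theta T).+1 - u, t - u)],
    (* s is decreasing in theta; it is constant when u = t *)
    (forall a b : nat, t <= a.+1 -> a <= b -> (weight t u b <= weight t u a)%R)
    /\ (u < t -> forall a b : nat, t <= a.+1 -> a < b ->
          (weight t u b < weight t u a)%R),
    (lhs <= rhs)%R
  & [/\
      3 <= t -> iso H (star t.-1) ->
        (lhs = rhs <-> forall v : G, t.-1 <= deg v),
      u = 1 -> iso H (star 1) ->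
        (lhs = rhs <->
           (forall v : G, deg v != 0)
           /\ forall C, C \in components G -> regular (induced C))
    & (* u = t has to be excluded: both sides are then N(K_t, G) for every G *)
      u < t -> 2 <= u \/ ~ is_star H ->
        (lhs = rhs <->
           forall C, C \in components G -> has_clique u (induced C) ->
             complete (induced C) /\ t <= #|C|)]].

Proof.
subst t => lhs rhs; case/andP: u_dom => u_gt0 u_le.
have u_le_H : u <= #|H| by apply: leq_trans u_le (max_card _).
have [D [D_Dom cD eF]] := del_domE u_le.
have D_gt0 : 0 < #|D| by rewrite cD.
have [le eqi] := global_sum G D_Dom D_gt0.
(* Equality amounts to saturation of every [u]-clique, which the three cases translate into
   conditions on [G]. *)
have sat : lhs = rhs <-> all_saturated G D.
  rewrite /lhs /rhs eF -cD; split=> [/eqP|h]; last apply/eqP.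
    rewrite eqi => /forallP h U /eqP cU clU.
    by have /implyP := h U; rewrite cU clU; apply.
  by rewrite eqi; apply/forallP => U; apply/implyP => /andP[/eqP cU clU]; apply: h.
split.
- move=> T TH; have [DT tT] := copy_theta dom_H TH.
  by split=> //; rewrite bin_gt0 leq_sub2r.
- split=> [a b ta ab|ut a b ta ab]; first exact: (weight_leif u_le_H ta ab).
  have [wle weq] := weight_leif u_le_H ta (ltnW ab).
  by rewrite lt_neqAle wle weq ltn_eqF //= gtn_eqF.
- by rewrite /lhs /rhs eF -cD.
- split=> [t3 isoH|u1 isoH|ut hstar]; rewrite sat.
  + by apply: (all_saturated_star _ D_Dom D_gt0 _ isoH); rewrite -ltnS prednK // ltnW // ltnW.
  + by apply: all_saturated_edge => //; rewrite cD.
  + by rewrite -cD; apply: all_saturated_complete; rewrite ?cD.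
Qed.
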